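(* Consider one-dimensional Internal Diffusion Limited Aggregation on $\mathbb{Z}$, defined as follows. Initially the set of occupied sites is $\{0\}$. Particles are released one at a time at the origin; each particle performs a simple symmetric random walk on $\mathbb{Z}$ (at each step moving $+1$ or $-1$ with probability $\tfrac12$ each, independently, like tossing a fair coin) until it first reaches an unoccupied site, at which point it stops, that site becomes occupied, and the next particle is released at the origin. After $n-1$ particles have settled, the set of occupied sites is an interval of $n$ integers containing $0$. For $n \ge 1$ and $0 \le k \le n-1$, let $P(n,k)$ denote the probability that, at the moment when there are exactly $n$ occupied sites, exactly $k$ of the occupied sites are positive integers. Then for all $n \geq 1$ and $0 \leq k \leq n-1$, \[ P(n,k) = \frac{\left\langle {n \atop k} \right\rangle}{n!}, \] where $\left\langle {n \atop k} \right\rangle$ is the Eulerian number.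
   Context: For $n \ge 1$ and $0 \le k \le n-1$, the Eulerian number $\left\langle {n \atop k} \right\rangle$ is the number of permutations of $\{1,2,\dots,n\}$ with exactly $k$ descents (a descent of $w$ is an index $i$ with $w(i) > w(i+1)$). *)

(* Defs.v *)
From HB Require Import structures.
From mathcomp Require Import all_boot all_order all_fingroup all_algebra finmap.
From mathcomp Require Import all_classical all_reals all_analysis.
From mathcomp Require Import zify.

Set Implicit Arguments.
Unset Strict Implicit.
Unset Printing Implicit Defensive.

Import Order.TTheory GRing.Theory Num.Theory.

(* Positions are 0-based: i is a descent of w when i.+1 < n and
   w (i.+1) < w i. *)
Definition descents (n : nat) (w : 'S_n) : {set 'I_n} :=
  [set i : 'I_n | [exists j : 'I_n, (j == i.+1 :> nat) && (w j < w i)%N]].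

Definition eulerian (n k : nat) : nat :=
  #|[set w : 'S_n | #|descents w| == k]|.

Local Open Scope classical_set_scope.
Local Open Scope ring_scope.

Definition independent_RVs (d d' : measure_display) (T : measurableType d)
    (T' : measurableType d') (R : realType) (P : probability T R)
    (I : eqType) (X : I -> {RV P >-> T'}) : Prop :=
  forall (s : seq I) (B : I -> set T'), uniq s ->
    (forall i, i \in s -> measurable (B i)) ->
    P (\bigcap_(i in [set` s]) (X i @^-1` B i)) =
    (\prod_(i <- s) P (X i @^-1` B i))%E.

Definition fair_coin (d : measure_display) (T : measurableType d)
    (R : realType) (P : probability T R) (X : {RV P >-> bool}) : Prop :=
  forall b : bool, P (X @^-1` [set b]) = (2^-1)%:E.

(* c s = true means that the (s+1)-st step is +1. *)
Definition walk (c : nat -> bool) (t : nat) : int :=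
  \sum_(s < t) (if c s then 1 else -1).

(* The new occupied set, or None if the walk never leaves A, in which case the
   particle never settles. *)
Definition release (c : nat -> bool) (A : {fset int}) : option {fset int} :=
  if pselect (exists t, walk c t \notin A) is left exit
  then Some (walk c (ex_minn exit) |` A)%fset else None.

(* c j is the coin sequence driving particle j; the value is None if one of the
   first m particles never settles, as then no later particle is released. *)
Fixpoint occupied (c : nat -> nat -> bool) (m : nat) : option {fset int} :=
  if m is m'.+1 then obind (release (c m')) (occupied c m')
  else Some [fset 0%Z]%fset.

Definition idla_event (Omega : Type) (X : nat -> nat -> Omega -> bool)
    (n k : nat) : set Omega :=
  [set w | exists (m : nat) (A : {fset int}),
     [/\ occupied (fun j t => X j t w) m = Some A,
         #|` A|%fset = n
       & #|` [fset x in A | (0 < x)%R]|%fset = k] ].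

(* By this lemma, the moment m in idla_event can only be n.-1. *)
Lemma occupied_interval (c : nat -> nat -> bool) (m : nat) (A : {fset int}) :
  occupied c m = Some A ->
  #|` A|%fset = m.+1 /\
  exists a b : nat, (a + b)%N = m /\
    forall x : int, (x \in A) = (- a%:Z <= x <= b%:Z).
Proof.
elim: m A => [|m IH] A /=.
  move=> [<-]; split; first by rewrite cardfs1.
  exists 0%N, 0%N; split => // x; rewrite inE; lia.
case E: (occupied c m) => [B|] //=.
have [cB [a [b [abm memB]]]] := IH _ E.
rewrite /release; case: pselect => // e [<-].
case: ex_minnP => t nB tmin; split; first by rewrite cardfsU1 nB cB.
have B0 : 0 \in B by rewrite memB; lia.
case: t nB tmin => [|t] nB tmin.
  by move: nB; rewrite /walk big_ord0 B0.
have tB : walk (c m) t \in B.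
  by apply/negPn/negP => /tmin; rewrite ltnn.
have walkS : walk (c m) t.+1 = walk (c m) t + (if c m t then 1 else -1).
  by rewrite /walk big_ord_recr.
have {tmin} : walk (c m) t.+1 = b%:Z + 1 \/ walk (c m) t.+1 = - a%:Z - 1.
  by move: nB tB; rewrite walkS !memB; case: (c m t) => ? ?; lia.
case=> ->; [exists a, b.+1 | exists a.+1, b]; split; try lia.
  by move=> x; rewrite !inE memB; lia.
by move=> x; rewrite !inE memB; lia.
Qed.

(* Main.v *)
(* When the occupied set is the segment [-a, b], the probability that the walk
   from 0 leaves it at a given end is the limit of its finite-horizon analogues,
   hence a discrete harmonic function of the starting point; it is therefore
   affine, which gives (b + 1) / (a + b + 2) for the left end and
   (a + 1) / (a + b + 2) for the right end. The walks being independent, the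
   numbers n! P(n, k) satisfy
     u(n + 1, k) = (k + 1) u(n, k) + (n + 1 - k) u(n, k - 1).
   The Eulerian numbers satisfy the same recurrence, as is seen by inserting the
   maximum in all possible positions of a permutation.
   Independence is only ever used against cylinders on finitely many coins not
   yet tossed: every event describing the past is shown to be independent of
   these, which avoids generated sigma-algebras. *)
Require Import Defs.
From HB Require Import structures.
From mathcomp Require Import all_boot all_order all_fingroup all_algebra finmap.
From mathcomp Require Import all_classical all_reals all_analysis.
From mathcomp Require Import zify ring lra.

Import Order.TTheory GRing.Theory Num.Theory.
Import numFieldNormedType.Exports.

Set Implicit Arguments.
Unset Strict Implicit.
Unset Printing Implicit Defensive.

Local Open Scope classical_set_scope.
Local Open Scope ring_scope.

(** * Eulerian numbers *)

(** Positions are plain naturals here, so that the sum of descents can be cut and shifted without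
    casts between ordinals. *)
Definition word (n : nat) (w : 'S_n.+1) (i : nat) : nat := w (inord i).

Lemma card_descents (n : nat) (w : 'S_n.+1) :
  #|descents w| = (\sum_(0 <= i < n) (word w i.+1 < word w i))%N.
Proof.
rewrite big_mkord -sum1_card big_mkcond big_ord_recr /= [X in (_ + X)%N](_ : _ = 0%N).
  rewrite addn0; apply: eq_bigr => i _; rewrite inE /word.
  have -> : [exists j : 'I_n.+1, (j == i.+1 :> nat) && (w j < w (widen_ord (leqnSn n) i))%N]
    = (w (inord i.+1) < w (inord i))%N.
    have -> : widen_ord (leqnSn n) i = inord i.
      by apply: val_inj; rewrite /= inordK // ltnS ltnW.
    apply/existsP/idP => [[j /andP[/eqP ji]]|lt]; first by rewrite -ji inord_val.
    by exists (inord i.+1); rewrite lt andbT inordK // ltnS.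
  by case: ltnP.
case: ifP => //; rewrite inE => /existsP[j /andP[/eqP jn _]].
by have := ltn_ord j; rewrite jn ltnn.
Qed.

Lemma word_lift_perm (n : nat) (w : 'S_n.+1) (i : 'I_n.+2) (j : nat) :
  (j < n.+2)%N ->
  word (lift_perm i ord_max w) j =
    if (j < i)%N then word w j else if j == i then n.+1 else word w j.-1.
Proof.
move=> jn; rewrite /word.
have [ji|/negPf ij] := eqVneq j i.
  by rewrite ji ltnn inord_val lift_perm_id.
have ji' : i != inord j.
  by apply/eqP => e; move: ij; rewrite e inordK // eqxx.
case: (unliftP i (inord j)) => [k e|e]; last by rewrite e eqxx in ji'.
rewrite e lift_perm_lift /= /bump leqNgt ltn_ord add0n.
have ej : j = bump i k by rewrite -[j](@inordK n.+1) // e.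
case: ifP => ltji; congr (nat_of_ord (w _)); apply: val_inj.
  by rewrite /= inordK; move: ej ltji (ltn_ord k); rewrite /bump; case: leqP => /=; lia.
by rewrite /= inordK; move: ej ltji (ltn_ord k); rewrite /bump; case: leqP => /=; lia.
Qed.

(* Inserting the maximum in front of position [i] creates a descent, unless [i]
   is the end of the word or the gap before [i] is already a descent. *)
Lemma card_descents_lift_perm (n : nat) (w : 'S_n.+1) (i : 'I_n.+2) :
  #|descents (lift_perm i ord_max w)| =
  (#|descents w| +
   ~~ ((i == n.+1 :> nat) || (0 < i) && (word w i < word w i.-1)))%N.
Proof.
rewrite !card_descents.
set f := word w; have fn j : (f j < n.+1)%N by exact: ltn_ord.
(* The word after insertion: [f] before [i], the maximum at [i], then [f] shifted by one. *)
pose g j := if (j < i)%N then f j else if j == i then n.+1 else f j.-1.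
have -> : (\sum_(0 <= j < n.+1) (word (lift_perm i ord_max w) j.+1
      < word (lift_perm i ord_max w) j) = \sum_(0 <= j < n.+1) (g j.+1 < g j))%N.
  rewrite !big_nat; apply: eq_bigr => j jn; rewrite !word_lift_perm //; lia.
have lo k : (k < i)%N ->
    (\sum_(0 <= j < k) (g j.+1 < g j) = \sum_(0 <= j < k) (f j.+1 < f j))%N.
  move=> ki; rewrite !big_nat; apply: eq_bigr => j jk; rewrite /g.
  by rewrite !ifT //; lia.
have hi : (\sum_(i.+1 <= j < n.+1) (g j.+1 < g j)
           = \sum_(i <= j < n) (f j.+1 < f j))%N.
  rewrite big_add1 /= !big_nat; apply: eq_bigr => j jk; rewrite /g.
  by rewrite !ifF //=; lia.
have gi : g i = n.+1 by rewrite /g ltnn eqxx.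
have gi1 : g i.+1 = f i by rewrite /g ifF ?ifF //; lia.
have := ltn_ord i; rewrite ltnS leq_eqVlt => /predU1P[iE|iltn].
  rewrite iE eqxx /= addn0 big_nat_recr //= lo; last by rewrite iE.
  rewrite -{1}iE gi [(n.+1 < _)%N](_ : _ = false) ?addn0 //.
  have := fn n; rewrite /g; rewrite iE ltnS leqnn; lia.
have [i0|i0] := posnP i.
  rewrite big_nat_recl // -i0; move: hi; rewrite big_add1 i0 /= => ->.
  by rewrite -i0 gi gi1 fn addnC; congr (_ + _)%N; rewrite i0.
(* The only gap of [w] that is lost is the one between [i.-1] and [i]; an ascent to the maximum
   followed by a descent from it takes its place. *)
rewrite (big_cat_nat (n := i.-1)) /=; [|lia|lia].
rewrite (@big_cat_nat _ _ _ i.-1 0 n) /=; [|lia|lia].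
rewrite lo; last lia.
rewrite (big_ltn (m := i.-1)) ?(@big_ltn _ _ _ i.-1 n); [|lia|lia].
rewrite prednK // (@big_ltn _ _ _ i n.+1) // hi gi gi1 fn.
have -> : (n.+1 < g i.-1)%N = false.
  by rewrite /g ifT; [have := fn i.-1; lia|lia].
by rewrite (_ : (i == n.+1 :> nat) = false) /=; [case: (f i < _)%N; lia|lia].
Qed.

(** The end of the word accounts for the extra one, position 0 is never neutral, and the positions
    in between are neutral exactly at descents. *)
Lemma count_neutral_positions (n : nat) (w : 'S_n.+1) :
  (\sum_(i < n.+2)
     ((i == n.+1 :> nat) || (0 < i) && (word w i < word w i.-1))
   = #|descents w|.+1)%N.
Proof.
rewrite big_ord_recr /= eqxx /= addn1 big_ord_recl /= add0n card_descents.
congr _.+1; rewrite big_mkord; apply: eq_bigr => i _ /=.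
by rewrite /bump /= add1n eqSS ltn_eqF // ltnS ltnW.
Qed.

(** The insertion position is recovered as the preimage of the maximum, and the permutation from the
    remaining values; surjectivity then follows by counting. *)
Lemma lift_perm_max_bij (n : nat) :
  bijective (fun p : 'I_n.+1 * 'S_n => lift_perm p.1 ord_max p.2).
Proof.
apply: inj_card_bij; last first.
  by rewrite card_prod card_ord !card_Sn factS.
move=> [i s] [j t] /= e.
have ij : i = j.
  apply: (@perm_inj _ (lift_perm j ord_max t)).
  by rewrite -{1}e !lift_perm_id.
subst j; congr pair; apply/permP => k.
have := congr1 (fun u : 'S_n.+1 => u (lift i k)) e.
by rewrite /= !lift_perm_lift => /lift_inj.
Qed.

Lemma card_descents_le (n : nat) (w : 'S_n.+1) : (#|descents w| <= n)%N.
Proof.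
rewrite card_descents -[leqRHS]subn0 -[leqRHS]muln1 -sum_nat_const_nat.
by apply: leq_sum => i _; exact: leq_b1.
Qed.

Lemma eulerian_sum (n k : nat) :
  (eulerian n k = \sum_(w : 'S_n) (#|descents w| == k))%N.
Proof.
rewrite /eulerian -sum1_card big_mkcond; apply: eq_bigr => w _.
by rewrite inE; case: eqP.
Qed.

Lemma eulerian_gt (n k : nat) : (n < k)%N -> eulerian n.+1 k = 0%N.
Proof.
move=> nk; rewrite eulerian_sum big1 // => w _; apply/eqP; rewrite eqb0.
by have := card_descents_le w; lia.
Qed.

(** Permutations are grouped by what remains after deleting the maximum. If [d] descents remain,
    [d + 1] of the [n + 2] insertions are neutral and the others create one descent. *)
Lemma eulerian_insert (n k : nat) :
  (eulerian n.+2 k = \sum_(w : 'S_n.+1)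
    ((#|descents w| == k) * #|descents w|.+1
     + (#|descents w|.+1 == k) * (n.+1 - #|descents w|)))%N.
Proof.
rewrite eulerian_sum (reindex _ (onW_bij _ (@lift_perm_max_bij n.+1))) /=.
rewrite -(pair_bigA _ (fun i w => (#|descents (lift_perm i ord_max w)| == k) : nat)).
rewrite exchange_big /=; apply: eq_bigr => w _.
pose b (i : 'I_n.+2) := (i == n.+1 :> nat) || (0 < i)%N && (word w i < word w i.-1)%N.
have bE : (\sum_(i < n.+2) b i = #|descents w|.+1)%N := count_neutral_positions w.
have bC : (\sum_(i < n.+2) ~~ b i = n.+1 - #|descents w|)%N.
  have : (\sum_(i < n.+2) (b i + ~~ b i) = n.+2)%N.
    rewrite (eq_bigr (fun=> 1%N)) => [|i _]; last by case: (b i).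
    by rewrite sum_nat_const card_ord muln1.
  by rewrite big_split /= bE => e; rewrite -subSS -[in RHS]e addKn.
rewrite -bC -[X in (_ * X + _)%N]bE !big_distrr -big_split; apply: eq_bigr => i _ /=.
rewrite card_descents_lift_perm -/(b i).
by case: (b i) => /=; rewrite ?addn1 !(muln0, muln1, addn0).
Qed.

Lemma eulerian0 (n : nat) : eulerian n.+2 0 = eulerian n.+1 0.
Proof.
rewrite eulerian_insert eulerian_sum; apply: eq_bigr => w _.
by case: eqP => [->|] //=; rewrite muln1.
Qed.

Lemma eulerianS (n k : nat) :
  (eulerian n.+2 k.+1 =
   k.+2 * eulerian n.+1 k.+1 + (n.+1 - k) * eulerian n.+1 k)%N.
Proof.
rewrite eulerian_insert !eulerian_sum !big_distrr -big_split /=.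
apply: eq_bigr => w _; rewrite eqSS mulnC [in X in (_ + X)%N]mulnC.
by congr addn; case: eqP => [->|]; rewrite ?muln0.
Qed.

Lemma eulerian1 : eulerian 1 0 = 1%N.
Proof.
rewrite /eulerian (_ : [set w | _] = [set: 'S_1])%SET ?cardsT ?card_Sn //.
by apply/setP => w; rewrite !inE; have := card_descents_le w; rewrite leqn0.
Qed.

(** * Exit from a segment *)

Definition step (b : bool) : int := if b then 1 else -1.

(* Started at [x] at time [t], the walk leaves [A] within [N] steps and does so
   at [y]. *)
Fixpoint exits (A : {fset int}) (y : int) (c : nat -> bool) (t N : nat)
    (x : int) : bool :=
  if x \notin A then x == y else
  if N is N'.+1 then exits A y c t.+1 N' (x + step (c t)) else false.

(** The probability of [exits] for fair coins, by conditioning on the first step. Being a recursion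
    on numbers, it can be studied before any measure enters. *)
Fixpoint exit_prob (R : realType) (A : {fset int}) (y : int) (N : nat)
    (x : int) : R :=
  if x \notin A then (x == y)%:R else
  if N is N'.+1 then (exit_prob R A y N' (x + 1) + exit_prob R A y N' (x - 1)) / 2
  else 0.

(** Links the step-by-step recursion, suited to conditioning, with the first exit time [s] of the
    walk, which is what [release] uses. *)
Lemma exitsP (A : {fset int}) (y : int) (c : nat -> bool) (N t : nat) :
  reflect (exists s, [/\ (t <= s <= t + N)%N, walk c s = y, y \notin A
                      & forall r, (t <= r < s)%N -> walk c r \in A])
          (exits A y c t N (walk c t)).
Proof.
(* If the walk is already outside at time [u], the only admissible [s] is [u] itself. *)
have stop M u : walk c u \notin A -> reflect (exists s, [/\ (u <= s <= u + M)%N,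
    walk c s = y, y \notin A & forall r, (u <= r < s)%N -> walk c r \in A])
    (walk c u == y).
  move=> nA; apply: (iffP eqP) => [e|[s [us sy _ sA]]].
    by exists u; split; rewrite -?e //; lia.
  have [->//|su] := eqVneq u s.
  by move: nA; rewrite sA //; lia.
elim: N t => [|N IH] t /=; case: ifPn => [/stop//|/negPn tA].
  constructor => -[s [ts sy yA _]].
  have e : s = t by lia.
  by move: yA; rewrite -sy e tA.
have -> : walk c t + step (c t) = walk c t.+1 by rewrite /walk big_ord_recr.
apply: (iffP (IH _)) => -[s [ts sy yA sA]]; exists s; split => //.
- lia.
- by move=> r rs; have [->//|rt] := eqVneq r t; apply: sA; lia.
- have [e|st] := eqVneq s t; last lia.
  by move: yA; rewrite -sy e tA.
- by move=> r rs; apply: sA; lia.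
Qed.

(** Because [y] lies outside [A], it can be read off from the enlarged set, so the new occupied set
    determines the exit site. *)
Lemma exits_release (c : nat -> bool) (A : {fset int}) (y : int) :
  0 \in A -> (exists N, exits A y c 0 N 0) <->
  y \notin A /\ release c A = Some (y |` A)%fset.
Proof.
move=> A0; have w0 : walk c 0 = 0 by rewrite /walk big_ord0.
rewrite -{1}w0 /release; split => [[N /exitsP[s [_ sy yA sA]]]|].
  split=> //; case: pselect => [e|[]]; last by exists s; rewrite sy.
  case: ex_minnP => t tA /(_ s); rewrite sy => /(_ yA) ts.
  have [->|st] := eqVneq t s; first by rewrite sy.
  by move: tA; rewrite sA //; lia.
case: pselect => [e|_ []//] [yA []].
case: ex_minnP => t tA tmin eq.
exists t; apply/exitsP; exists t; split => //; first by rewrite leqnn.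
  have : y \in (walk c t |` A)%fset by rewrite eq fset1U1.
  by rewrite in_fset1U (negPf yA) orbF => /eqP.
by move=> r /andP[_ rt]; apply/negPn/negP => /tmin; lia.
Qed.

Lemma exits_mono A y c t N M x :
  (N <= M)%N -> exits A y c t N x -> exits A y c t M x.
Proof.
elim: N M t x => [|N IH] [|M] t x //= NM; case: ifP => // _.
exact: IH.
Qed.

Lemma exit_prob_ge0 (R : realType) A y N x : 0 <= exit_prob R A y N x.
Proof.
elim: N x => [|N IH] x /=; case: ifP => // _.
by rewrite divr_ge0 ?addr_ge0.
Qed.

Lemma exit_prob_le1 (R : realType) A y N x : exit_prob R A y N x <= 1.
Proof.
elim: N x => [|N IH] x /=; case: ifP => // _; rewrite ?lern1 ?leq_b1 //.
by have := IH (x + 1); have := IH (x - 1); lra.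
Qed.

Lemma exit_prob_nondecreasing (R : realType) A y x :
  nondecreasing_seq (fun N => exit_prob R A y N x).
Proof.
apply/nondecreasing_seqP => N; elim: N x => [|N IH] x.
  rewrite /=; case: ifP => // _.
  by rewrite divr_ge0 ?addr_ge0 //; case: ifP.
move: (IH (x + 1)) (IH (x - 1)) => h1 h2.
rewrite [leLHS]/= [leRHS]/=; case: ifP => // _.
move: h1 h2; rewrite /=; lra.
Qed.

Definition exit_lim (R : realType) A y x : R :=
  limn (fun N => exit_prob R A y N x).

Lemma exit_prob_cvg (R : realType) A y x :
  exit_prob R A y N x @[N --> \oo] --> exit_lim R A y x.
Proof.
apply: nondecreasing_is_cvgn; first exact: exit_prob_nondecreasing.
by exists 1 => _ [N _ <-]; exact: exit_prob_le1.
Qed.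

Lemma exit_lim_out (R : realType) A y x :
  x \notin A -> exit_lim R A y x = (x == y)%:R.
Proof.
move=> xA; apply: cvg_lim => //.
rewrite (_ : (fun N => _) = fun=> (x == y)%:R); first exact: cvg_cst.
by apply: funext => -[|N] /=; rewrite xA.
Qed.

(** The recursion for [exit_prob] passes to the limit, since shifting the horizon by one leaves the
    limit unchanged. *)
Lemma exit_lim_harmonic (R : realType) A y x : x \in A ->
  exit_lim R A y x = (exit_lim R A y (x + 1) + exit_lim R A y (x - 1)) / 2.
Proof.
move=> xA; apply: cvg_lim => //; rewrite -cvg_shiftS /=.
rewrite xA /=; apply: cvgM; last exact: cvg_cst.
by apply: cvgD; exact: exit_prob_cvg.
Qed.

(** Harmonicity at the interior points 1 to [n] makes all consecutive differences up to [n.+1]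
    equal. *)
Lemma harmonic_affine (R : realType) (f : nat -> R) (n : nat) :
  (forall i, (i < n)%N -> f i.+1 = (f i.+2 + f i) / 2) ->
  forall i, (i <= n.+1)%N -> f i = f 0%N + i%:R * (f 1%N - f 0%N).
Proof.
move=> fh i; elim/ltn_ind: i => -[|[|i]] IH ni; [ring|ring|].
have := fh i; rewrite (IH i) ?(IH i.+1) //; [|lia..].
move=> /(_ ni) e; rewrite -(natr1 i.+1); move: e; rewrite -(natr1 i).
set d := f 1%N - f 0%N.
move: (i%:R) => r e; lra.
Qed.

(** * Exit probabilities of an integer segment (gambler's ruin) *)

Definition int_segment (a b : nat) : {fset int} :=
  [fset i%:Z - a%:Z | i in iota 0 (a + b).+1]%fset.

Lemma mem_int_segment a b x : (x \in int_segment a b) = (- a%:Z <= x <= b%:Z).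
Proof.
apply/imfsetP/idP => [[i /=]|h].
  by rewrite inE mem_iota => ? ->; lia.
by exists (absz (x + a%:Z)); rewrite /= ?inE ?mem_iota; lia.
Qed.

Lemma exit_lim_int_segment (R : realType) (a b : nat) (y : int)
    (h := fun x : int => exit_lim R (int_segment a b) y x) :
  h 0 = (- a.+1%:Z == y)%:R
        + a.+1%:R / (a + b).+2%:R * ((b.+1%:Z == y)%:R - (- a.+1%:Z == y)%:R).
Proof.
(* Shifted coordinates: the two exit sites become 0 and [(a + b).+2], and the origin becomes
   [a.+1]. *)
pose f i := h (i%:Z - a.+1%:Z).
have fE i : (i < (a + b).+1)%N -> f i.+1 = (f i.+2 + f i) / 2.
  move=> i_lt; rewrite /f /h exit_lim_harmonic; last by rewrite mem_int_segment; lia.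
  by congr ((exit_lim _ _ _ _ + exit_lim _ _ _ _) / _); lia.
have f0 : f 0%N = (- a.+1%:Z == y)%:R.
  by rewrite /f /h sub0r exit_lim_out // mem_int_segment; lia.
have fn : f (a + b).+2 = (b.+1%:Z == y)%:R.
  rewrite /f /h exit_lim_out; first by congr ((_ == _)%:R); lia.
  by rewrite mem_int_segment; lia.
have fa : h 0 = f a.+1 by rewrite /f subrr.
rewrite fa (harmonic_affine fE) ?f0; last lia.
(* The boundary value at the last index [(a + b).+2] determines the slope. *)
have := harmonic_affine fE (leqnn _); rewrite fn f0 => ->.
by rewrite [X in _ / _ * X]addrC addKr mulrA divfK // pnatr_eq0.
Qed.

Lemma exit_lim_left (R : realType) (a b : nat) :
  exit_lim R (int_segment a b) (- a.+1%:Z) 0 = b.+1%:R / (a + b).+2%:R.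
Proof.
rewrite exit_lim_int_segment eqxx (_ : (_ == _) = false) ?sub0r; last lia.
have n0 : (a + b).+2%:R != 0 :> R by rewrite pnatr_eq0.
rewrite mulrN1 -[X in X - _](divff n0) -mulrBl.
by congr (_ / _); rewrite -natrB; [congr _%:R|]; lia.
Qed.

Lemma exit_lim_right (R : realType) (a b : nat) :
  exit_lim R (int_segment a b) b.+1%:Z 0 = a.+1%:R / (a + b).+2%:R.
Proof.
rewrite exit_lim_int_segment eqxx (_ : (_ == _) = false); last lia.
by rewrite subr0 mulr1 add0r.
Qed.

(** * Occupied segments before and after one release *)

Lemma card_int_segment_pos (a b : nat) :
  #|` [fset x in int_segment a b | (0 < x)%R]|%fset = b.
Proof.
have -> : [fset x in int_segment a b | (0 < x)%R]%fset
        = [fset i%:Z | i in iota 1 b]%fset.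
  apply/fsetP => x; rewrite !inE /= mem_int_segment.
  apply/idP/imfsetP => [h|[i /=]]; last by rewrite mem_iota => ? ->; lia.
  by exists (absz x); rewrite /= ?mem_iota; lia.
rewrite card_imfset /=; last by move=> i j [].
by rewrite undup_id ?size_iota // iota_uniq.
Qed.

(** Both ends are treated at once: the disjunction says that adding [y] to the old segment gives the
    new one. The particle released is the one numbered [m]. *)
Lemma occupied_next (c : nat -> nat -> bool) (a b : nat) (y : int) (a' b' : nat)
    (m := (a + b)%N) :
  occupied c m = Some (int_segment a b) ->
  (y == - a.+1%:Z) && (a' == a.+1) && (b' == b)
    || (y == b.+1%:Z) && (a' == a) && (b' == b.+1) ->
  (exists N, exits (int_segment a b) y (c m) 0 N 0) <->
  occupied c m.+1 = Some (int_segment a' b').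
Proof.
move=> occ yE; have A0 : 0 \in int_segment a b by rewrite mem_int_segment; lia.
rewrite exits_release //= occ /=.
have yA : y \notin int_segment a b by rewrite mem_int_segment; lia.
have <- : (y |` int_segment a b)%fset = int_segment a' b'.
  by apply/fsetP => x; rewrite in_fset1U !mem_int_segment; lia.
by split=> [[]|].
Qed.

(** A release only adds sites, so the old segment is contained in the new one; as the lengths differ
    by one, exactly one end has moved. *)
Lemma occupied_prev (c : nat -> nat -> bool) (m a' b' : nat) :
  (a' + b' = m.+1)%N -> occupied c m.+1 = Some (int_segment a' b') ->
  exists a b, [/\ (a + b)%N = m, occupied c m = Some (int_segment a b) &
    (a' == a.+1) && (b' == b) || (a' == a) && (b' == b.+1)].
Proof.
move=> ab' /=; case E: (occupied c m) => [B|] //=.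
have [_ [a [b [abm memB]]]] := occupied_interval E.
have -> : B = int_segment a b by apply/fsetP => x; rewrite memB mem_int_segment.
move=> rel; exists a, b; split => //.
have : (int_segment a b `<=` int_segment a' b')%fset.
  move: rel; rewrite /release; case: pselect => // ? [<-]; exact: fsubsetU1.
move=> /fsubsetP sub.
have := sub b%:Z; have := sub (- a%:Z); rewrite !mem_int_segment.
by move=> /(_ ltac:(lia)) ? /(_ ltac:(lia)) ?; lia.
Qed.

(** * Independence of the coins still to be tossed *)

Section Coins.
Context (d : measure_display) (Omega : measurableType d) (R : realType).
Context (P : probability Omega R) (X : nat -> nat -> {RV P >-> bool}).

Definition cylinder (l : seq (nat * nat * bool)) : set Omega :=
  [set w | all (fun p => X p.1.1 p.1.2 w == p.2) l].

Lemma cylinder_cons p l :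
  cylinder (p :: l) = X p.1.1 p.1.2 @^-1` [set p.2] `&` cylinder l.
Proof.
apply/seteqP; split=> w; rewrite /cylinder /=; first by move=> /andP[/eqP].
by move=> [-> ->]; rewrite eqxx.
Qed.

Lemma cylinder_cat l1 l2 : cylinder (l1 ++ l2) = cylinder l1 `&` cylinder l2.
Proof. by apply/seteqP; split=> w; rewrite /cylinder /= all_cat => /andP. Qed.

Lemma measurable_coin j t (B : set bool) : measurable (X j t @^-1` B).
Proof. by rewrite -[X in measurable X]setTI; exact: measurable_funP. Qed.

Lemma measurable_cylinder l : measurable (cylinder l).
Proof.
elim: l => [|p l IH]; first by rewrite (_ : cylinder _ = setT) //; apply/seteqP.
by rewrite cylinder_cons; apply: measurableI => //; exact: measurable_coin.
Qed.

Lemma probability_cylinder (Xfair : forall j t, fair_coin (X j t))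
    (Xindep : independent_RVs (fun p : nat * nat => X p.1 p.2)) l :
  uniq (unzip1 l) -> P (cylinder l) = (2^-1 ^+ size l)%:E.
Proof.
(* No coin is prescribed twice, so [B i] is a singleton for each coin occurring in [l]. *)
move=> ul; pose B (i : nat * nat) : set bool := [set b | (i, b) \in l].
have BE i b : (i, b) \in l -> B i = [set b].
  move=> il; apply/seteqP; split=> [b'|_ ->//]; rewrite /B /= => il' {B}.
  elim: l ul il il' => //= -[j b0] l IH /andP[jl ul].
  rewrite !inE => /orP[/eqP[ij bb]|il] /orP[/eqP[ij' bb']|il'].
  - by rewrite bb bb'.
  - by move: jl; rewrite -ij; have /= -> := map_f fst il'.
  - by move: jl; rewrite -ij'; have /= -> := map_f fst il.
  - exact: IH.
have := Xindep (unzip1 l) B ul (fun _ _ => I).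
rewrite (_ : \bigcap_(i in _) _ = cylinder l) => [->|].
  rewrite big_map big_seq (eq_bigr (fun=> (2^-1)%:E)); last first.
    by move=> [i b] il /=; rewrite (BE _ _ il); exact: Xfair.
  rewrite -big_seq; elim: (l) => [|p l' IH]; first by rewrite big_nil.
  by rewrite big_cons IH /= exprS EFinM.
apply/seteqP; split=> w /=.
  move=> h; apply/allP => -[i b] il /=.
  by have := h i (map_f fst il); rewrite /= (BE _ _ il) => /= ->.
by move=> /allP h i /= /mapP[[i' b] il /= ->]; rewrite (BE _ _ il); have /eqP := h _ il.
Qed.

(* [E] is independent of the coins indexed by [Q]. *)
Definition fresh (Q : pred (nat * nat)) (E : set Omega) : Prop :=
  measurable E /\ forall l, uniq (unzip1 l) -> all Q (unzip1 l) ->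
    P (E `&` cylinder l) = (P E * (2^-1 ^+ size l)%:E)%E.

(** Tossing the coins of [l] leaves the others fresh: freshness of [E] is tested against the
    concatenation [l ++ l'], which repeats no coin since [Q'] avoids [l]. *)
Lemma fresh_cylinder (Q Q' : pred (nat * nat)) E l :
  fresh Q E -> uniq (unzip1 l) -> all Q (unzip1 l) ->
  (forall p, Q' p -> Q p && (p \notin unzip1 l)) ->
  fresh Q' (E `&` cylinder l).
Proof.
move=> [mE fE] ul Ql Q'Q; split.
  by apply: measurableI => //; exact: measurable_cylinder.
move=> l' ul' Q'l'; rewrite -setIA -cylinder_cat !fE //.
- by rewrite size_cat exprD EFinM muleA.
- rewrite /unzip1 map_cat cat_uniq ul ul' andbT /=.
  by apply/hasPn => p /(allP Q'l')/Q'Q/andP[].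
- rewrite /unzip1 map_cat all_cat Ql /=.
  by apply/allP => p /(allP Q'l')/Q'Q/andP[].
Qed.

Lemma fresh_sub (Q Q' : pred (nat * nat)) E : (forall p, Q' p -> Q p) -> fresh Q E -> fresh Q' E.
Proof.
move=> Q'Q [mE fE]; split=> // l ul /allP Ql; apply: fE => //.
by apply/allP => p /Ql/Q'Q.
Qed.

Lemma probabilityU E F : measurable E -> measurable F -> E `&` F = set0 ->
  P (E `|` F) = (P E + P F)%E.
Proof. exact: measureU. Qed.

Lemma freshU Q E F : fresh Q E -> fresh Q F -> E `&` F = set0 ->
  fresh Q (E `|` F).
Proof.
move=> [mE fE] [mF fF] EF0; split=> [|l ul Ql]; first exact: measurableU.
have mc := measurable_cylinder l.
rewrite setIUl !probabilityU //; [|exact: measurableI..|].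
  by rewrite ge0_muleDl // fE // fF.
by rewrite setIACA EF0 set0I.
Qed.

(** * Exit events of one particle and their probabilities *)

Definition exits_at A y j t N x : set Omega :=
  [set w | exits A y (fun s => X j s w) t N x].

Lemma exits_atS A y j t N x : x \in A ->
  exits_at A y j t N.+1 x =
    (cylinder [:: (j, t, true)] `&` exits_at A y j t.+1 N (x + 1)) `|`
    (cylinder [:: (j, t, false)] `&` exits_at A y j t.+1 N (x - 1)).
Proof.
move=> xA; apply/seteqP; split=> w; rewrite /exits_at /cylinder /= xA /= !andbT.
  by case: (X j t w) => /= h; [left|right].
by move=> [] [/eqP ->].
Qed.

Lemma exits_at_const A y j t N x : (x \notin A) || (N == 0%N) ->
  exits_at A y j t N x = if (x \notin A) && (x == y) then setT else set0.
Proof.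
move=> h; apply/seteqP; split=> w; case: N h => [|N]; rewrite /exits_at /=;
  by case: (x \notin A); case: (x == y).
Qed.

Lemma measurable_exits_at A y j t N x : measurable (exits_at A y j t N x).
Proof.
elim: N t x => [|N IH] t x; first by rewrite exits_at_const ?orbT //; case: ifP.
have [xA|xA] := boolP (x \in A); last first.
  by rewrite exits_at_const ?xA //; case: ifP.
rewrite exits_atS //.
by apply: measurableU; apply: measurableI => //; exact: measurable_cylinder.
Qed.

(** The induction is over all past events [E]: the coin tossed at time [t] is absorbed into [E],
    which stays fresh for the later coins of particle [j]. *)
Lemma probability_exits_at A y j t N x E :
  fresh (fun p => (p.1 == j) && (t <= p.2)%N) E ->
  P (E `&` exits_at A y j t N x) = (P E * (exit_prob R A y N x)%:E)%E.
Proof.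
elim: N t x E => [|N IH] t x E fE.
  rewrite exits_at_const ?orbT //=.
  by case: (x \notin A); case: (x == y); rewrite /= ?setIT ?setI0 ?mule1 ?mule0 ?measure0.
have [xA|xA] := boolP (x \in A); last first.
  rewrite exits_at_const ?xA //= xA.
  by case: (x == y); rewrite /= ?setIT ?setI0 ?mule1 ?mule0 ?measure0.
have fEb b : fresh (fun p => (p.1 == j) && (t < p.2)%N) (E `&` cylinder [:: (j, t, b)]).
  apply: fresh_cylinder fE _ _ _; rewrite //= ?eqxx ?leqnn //.
  move=> [j' t'] /= /andP[-> tt']; rewrite ltnW //= inE.
  by apply: contraL tt' => /eqP[_ ->]; rewrite ltnn.
have PEb b : P (E `&` cylinder [:: (j, t, b)]) = (P E * (2^-1)%:E)%E.
  by rewrite fE.2 //= eqxx leqnn.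
rewrite exits_atS // setIUr !setIA probabilityU.
- rewrite !IH // !PEb -!muleA -ge0_muleDr ?lee_fin ?mulr_ge0 ?exit_prob_ge0 //.
  by rewrite /= xA /= -!EFinM -EFinD; congr (_ * _%:E)%E; lra.
- by apply: measurableI; [exact: (fEb _).1|exact: measurable_exits_at].
- by apply: measurableI; [exact: (fEb _).1|exact: measurable_exits_at].
- apply/seteqP; split=> w //; rewrite /cylinder /= !andbT.
  by move=> [[[_ /eqP ->] _] [[_ /eqP]]].
Qed.

Definition exits_ever A y j : set Omega := \bigcup_N exits_at A y j 0 N 0.

Lemma measurable_exits_ever A y j : measurable (exits_ever A y j).
Proof. by apply: bigcupT_measurable => N; exact: measurable_exits_at. Qed.

(** Continuity from below, the exit events being increasing in the horizon. *)
Lemma probability_exits_ever A y j E :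
  fresh (fun p => p.1 == j) E ->
  P (E `&` exits_ever A y j) = (P E * (exit_lim R A y 0)%:E)%E.
Proof.
move=> fE; have mE := fE.1.
have mEN N : measurable (E `&` exits_at A y j 0 N 0).
  by apply: measurableI => //; exact: measurable_exits_at.
have : P (E `&` exits_at A y j 0 N 0) @[N --> \oo] --> P (E `&` exits_ever A y j).
  rewrite /exits_ever setI_bigcupr; apply: nondecreasing_cvg_mu => //.
    exact: bigcupT_measurable.
  move=> N M NM; apply/subsetPset; apply: setIS => w; exact: exits_mono.
move=> /cvg_lim <- //; apply: cvg_lim => //.
rewrite (_ : (fun N => _) = fun N => (P E * (exit_prob R A y N 0)%:E)%E).
  apply: cvgeZl; first exact: fin_num_measure.
  by apply: cvg_EFin; [exact: nearW|exact: exit_prob_cvg].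
apply: funext => N; apply: probability_exits_at.
by apply: fresh_sub fE => p /andP[].
Qed.

(** A cylinder on later particles can be absorbed into [E] without spoiling the coins of particle
    [m]; the exit formula then applies both to [E] and to [E] cut by the cylinder. *)
Lemma fresh_exits_ever A y m E : fresh (fun p => (m <= p.1)%N) E ->
  fresh (fun p => (m < p.1)%N) (E `&` exits_ever A y m).
Proof.
move=> fE; split.
  by apply: measurableI; [exact: fE.1|exact: measurable_exits_ever].
move=> l ul ml; rewrite setIAC !probability_exits_ever.
- by rewrite fE.2 1?muleAC // (sub_all _ ml) // => p /ltnW.
- by apply: fresh_sub fE => p /eqP ->.
- apply: fresh_cylinder fE ul _ _; first by rewrite (sub_all _ ml) // => p /ltnW.
  move=> p /eqP pm; rewrite pm leqnn; apply/negP => /(allP ml).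
  by rewrite pm ltnn.
Qed.

(** * The random evolution of the occupied segment *)

Definition settled (m b : nat) : set Omega :=
  [set w | (b <= m)%N /\
     occupied (fun j t => X j t w) m = Some (int_segment (m - b)%N b)].

Lemma settled_next m b b' y w :
  settled m b w -> y = - (m - b)%N.+1%:Z /\ b' = b \/ y = b.+1%:Z /\ b' = b.+1 ->
  exits_ever (int_segment (m - b)%N b) y m w <-> settled m.+1 b' w.
Proof.
move=> [bm occ] yb.
have := @occupied_next (fun j t => X j t w) (m - b) b y (m.+1 - b') b'.
rewrite subnK // => /(_ occ)[]; first by case: yb => -[-> ->]; lia.
move=> next prev; split=> [[N _ h]|[_ /prev[N h]]]; last by exists N.
by split; [case: yb => -[_ ->]; lia|apply: next; exists N].
Qed.

Lemma settled_prev m b' w : settled m.+1 b' w ->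
  exists2 b, settled m b w & b' = b \/ b' = b.+1.
Proof.
move=> [bm occ].
have [|a [b [ab occ' ab']]] := occupied_prev _ occ; first by rewrite subnK.
exists b; last lia.
by split; [lia|rewrite occ'; congr (Some (int_segment _ _)); lia].
Qed.

Lemma settledS0 m : settled m.+1 0 =
  settled m 0 `&` exits_ever (int_segment m 0) (- m.+1%:Z) m.
Proof.
apply/seteqP; split=> w h.
  have [b hb [|//]] := settled_prev h; move=> b0; subst b; split=> //.
  by have := (settled_next hb _).2 h; rewrite subn0; apply; left.
case: h => hb h; apply: (settled_next hb _).1; last by rewrite subn0; exact: h.
by left; rewrite subn0.
Qed.

Lemma settledSS m b : settled m.+1 b.+1 =
  (settled m b.+1 `&`
     exits_ever (int_segment (m - b.+1)%N b.+1) (- (m - b.+1)%N.+1%:Z) m) `|`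
  (settled m b `&` exits_ever (int_segment (m - b)%N b) b.+1%:Z m).
Proof.
apply/seteqP; split=> w.
  move=> h; have [b' hb [b'E|[b'E]]] := settled_prev h; subst b'.
    by left; split=> //; apply: (settled_next hb _).2 h; left.
  by right; split=> //; apply: (settled_next hb _).2 h; right.
by move=> [] [hb h]; apply: (settled_next hb _).1 h; [left|right].
Qed.

Lemma settled_disjoint m b : settled m b.+1 `&` settled m b = set0.
Proof.
apply/seteqP; split=> w // -[[_ occ] [_]].
(* The site [b.+1] belongs to one segment and not to the other. *)
by rewrite occ => -[/fsetP/(_ b.+1%:Z)]; rewrite !mem_int_segment; lia.
Qed.

(** Freshness and probability are proved together, since the probability of the next jump relies on
    the freshness of the current state. *)
Lemma probability_settled (Xfair : forall j t, fair_coin (X j t))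
    (Xindep : independent_RVs (fun p : nat * nat => X p.1 p.2)) m b :
  fresh (fun p => (m <= p.1)%N) (settled m b) /\
  P (settled m b) = ((eulerian m.+1 b)%:R / (m.+1)`!%:R)%:E.
Proof.
elim: m b => [|m IH] [|b].
- have -> : settled 0 0 = setT.
    apply/seteqP; split=> // w _; split=> //=; congr Some; apply/fsetP => x.
    by rewrite mem_int_segment inE; lia.
  (* Freshness of the sure event is the cylinder formula; fairness and independence enter the
     induction here. *)
  rewrite probability_setT eulerian1 divr1; split=> //; split=> // l ul _.
  by rewrite setTI probability_setT mul1e probability_cylinder.
- have -> : settled 0 b.+1 = set0 by apply/seteqP; split=> w // -[].
  rewrite measure0 eulerian_gt // mul0r; split=> //; split=> // l _ _.
  by rewrite set0I measure0 mul0e.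
- have [fr Pm] := IH 0%N; rewrite settledS0; split; first exact: fresh_exits_ever.
  rewrite probability_exits_ever; last by apply: fresh_sub fr => p /eqP ->.
  rewrite Pm exit_lim_left addn0 eulerian0 -EFinM; congr EFin.
  by rewrite [in RHS]factS natrM mulf_div mulr1 [X in _ / X = _]mulrC.
have [fr1 P1] := IH b.+1; have [fr2 P2] := IH b.
have rowm E : fresh (fun p => (m <= p.1)%N) E -> fresh (fun p => p.1 == m) E.
  by apply: fresh_sub => p /eqP ->.
have dis A y A' y' : settled m b.+1 `&` exits_ever A y m
    `&` (settled m b `&` exits_ever A' y' m) = set0.
  by rewrite setIACA settled_disjoint set0I.
rewrite settledSS; split; first by apply: freshU => //; exact: fresh_exits_ever.
rewrite probabilityU //; [|exact: (fresh_exits_ever _ _ _).1..].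
rewrite !probability_exits_ever ?P1 ?P2; [|exact: rowm..].
rewrite -!EFinM -EFinD; congr EFin.
rewrite exit_lim_left exit_lim_right eulerianS natrD [in RHS]factS.
rewrite (natrM _ m.+2) (natrM _ b.+2) (natrM _ (m.+1 - b)).
(* In this identity and the next, whenever the subtraction from [m] truncates, the Eulerian factor
   vanishes. *)
have left_jump : (eulerian m.+1 b.+1)%:R * (b.+2%:R / (m - b.+1 + b.+1).+2%:R) =
    (eulerian m.+1 b.+1)%:R * (b.+2%:R / m.+2%:R) :> R.
  have [bm|bm] := ltnP b m; first by rewrite subnK.
  by rewrite eulerian_gt ?ltnS // !mul0r.
have right_jump : (eulerian m.+1 b)%:R * ((m - b).+1%:R / (m - b + b).+2%:R) =
    (eulerian m.+1 b)%:R * ((m.+1 - b)%N%:R / m.+2%:R) :> R.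
  have [bm|bm] := leqP b m; first by rewrite subnK // subSn.
  by rewrite eulerian_gt // !mul0r.
rewrite ![_ / _ * _]mulrAC left_jump right_jump -mulrDl !mulrA -mulrDl -mulrA.
by rewrite -invfM (mulrC b.+2%:R) (mulrC (m.+1 - b)%N%:R).
Qed.

(** The number of sites fixes the number of particles, and the number of positive sites fixes the
    right end of the segment. *)
Lemma idla_event_settled n k : (1 <= n)%N ->
  idla_event (fun j t => X j t) n k = settled n.-1 k.
Proof.
move=> n1; apply/seteqP; split=> w.
  move=> [m [A [occ cA ck]]].
  have [cm [a [b [ab memA]]]] := occupied_interval occ.
  have AE : A = int_segment a b by apply/fsetP => x; rewrite memA mem_int_segment.
  have nm : n.-1 = m by rewrite -cA cm.
  have kb : k = b by rewrite -ck AE card_int_segment_pos.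
  rewrite nm kb; split; first lia.
  by rewrite occ AE; congr (Some (int_segment _ _)); lia.
move=> [kn occ]; exists n.-1, (int_segment (n.-1 - k) k); split=> //.
  by have [-> _] := occupied_interval occ; rewrite prednK.
exact: card_int_segment_pos.
Qed.

End Coins.

Theorem theorem1 (d : measure_display) (Omega : measurableType d)
    (R : realType) (P : probability Omega R)
    (X : nat -> nat -> {RV P >-> bool})
    (Xfair : forall j t : nat, fair_coin (X j t))
    (Xindep : independent_RVs (fun p : nat * nat => X p.1 p.2))
    (n k : nat) (hn : (1 <= n)%N) (hk : (k <= n - 1)%N) :
  P (idla_event (fun j t => X j t) n k) =
    ((eulerian n k)%:R / (n`!)%:R)%:E.
Proof.
rewrite idla_event_settled // (probability_settled Xfair Xindep _ _).2.
by rewrite prednK.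
Qed.
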